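(* Let $\{f_\theta\}_{\theta\in\Theta}$ be the one-parameter exponential family $f_\theta(y)=e^{\theta T(y)-b(\theta)}h(y)$ with respect to a $\sigma$-finite measure $\mu$, where $\Theta\subset\mathbb{R}$ is an interval and $b$ is differentiable everywhere on $\Theta$. Let $\epsilon>0$, let $\theta_0\in\Theta$ with $\theta_0\pm\epsilon\in\Theta$, let $A>0$, and let $\tau_G$ be the stopping time $$\tau_G=\inf\Big\{m\ge 1:\ \max_{1\le k\le m}\ \sup_{\theta\in\Theta:\,|\theta-\theta_0|\ge\epsilon}\ \sum_{i=k}^m\log\frac{f_\theta(Y_i)}{f_{\theta_0}(Y_i)}>A\Big\}.$$ Let $I(\theta)=\mathrm{KL}(f_\theta\|f_{\theta_0})=\int \log\frac{f_\theta}{f_{\theta_0}}\,f_\theta\,d\mu$, and assume that $I(\theta)$ increases with $|\theta-\theta_0|$ (i.e. $I$ is strictly increasing as $\theta\in\Theta$ moves away from $\theta_0$ on either side). 1. Let $g$ be a probability density with respect to $\mu$. Assume that for every $\theta\in\Theta$ with $|\theta-\theta_0|\ge\epsilon$ there is a constant $\kappa_{\theta,g}>0$ such that $$\int\Big(\frac{f_\theta(y)}{f_{\theta_0}(y)}\Big)^{\kappa_{\theta,g}}g(y)\,d\mu(y)=1,$$ and that there is a constant $\kappa_g$ with $0<\kappa_g\le\inf_{\theta\in\Theta:\,|\theta-\theta_0|\ge\epsilon}\kappa_{\theta,g}$. Then $$\mathsf{E}_g[\tau_G]\ \ge\ \frac{e^{\kappa_g A}}{2\left(\frac{A}{\min\{I(\theta_0+\epsilon),\,I(\theta_0-\epsilon)\}}+1\right)}.$$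 2. Let $\mathcal{G}$ be a family of probability densities with respect to $\mu$ such that every $g\in\mathcal{G}$ satisfies the assumption of part 1 with some constant $\kappa_g$, and assume there is a constant $\kappa^*$ with $0<\kappa^*\le\kappa_g$ for all $g\in\mathcal{G}$. Then for every $g\in\mathcal{G}$, $$\mathsf{E}_g[\tau_G]\ \ge\ \frac{e^{\kappa^* A}}{2\left(\frac{A}{\min\{I(\theta_0+\epsilon),\,I(\theta_0-\epsilon)\}}+1\right)}.$$
   Context: $T$ and $h\ge 0$ are real-valued measurable functions, and each $f_\theta$, $\theta\in\Theta$, is a probability density with respect to $\mu$. The log-likelihood ratio is $\log\frac{f_\theta(y)}{f_{\theta_0}(y)}=(\theta-\theta_0)T(y)-b(\theta)+b(\theta_0)$. $Y_1,Y_2,\dots$ is an i.i.d. observation sequence; $\mathsf{E}_g$ denotes expectation under the probability measure for which all the $Y_i$ are i.i.d. with density $g$ with respect to $\mu$. The infimum of the empty set is $+\infty$, and $\mathsf{E}_g[\tau_G]$ may be $+\infty$. *)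

(* Defs.v *)
From HB Require Import structures.
From mathcomp Require Import all_boot all_order all_algebra.
From mathcomp Require Import all_classical all_reals all_analysis.
Set Implicit Arguments.
Unset Strict Implicit.
Unset Printing Implicit Defensive.
Import Order.TTheory GRing.Theory Num.Theory.
Import numFieldNormedType.Exports.
Local Open Scope classical_set_scope.
Local Open Scope ring_scope.

Definition is_density d (Y : measurableType d) (R : realType)
    (mu : {measure set Y -> \bar R}) (g : Y -> R) : Prop :=
  [/\ measurable_fun setT g,
      forall y, 0 <= g y &
      (\int[mu]_y (g y)%:E = 1)%E].

Definition expfam (Y : Type) (R : realType) (T h : Y -> R) (b : R -> R)
    (theta : R) (y : Y) : R :=
  expR (theta * T y - b theta) * h y.

(* The log-likelihood ratio log (f_theta / f_theta0).  The closed form is used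
   at every y, also where h y = 0 and the quotient f_theta / f_theta0 is 0 / 0:
   observations drawn from another density may charge that set. *)
Definition llr (Y : Type) (R : realType) (T : Y -> R) (b : R -> R)
    (theta0 theta : R) (y : Y) : R :=
  (theta - theta0) * T y - b theta + b theta0.

(* The likelihood ratio f_theta / f_theta0, with the same reading as llr. *)
Definition lr (Y : Type) (R : realType) (T : Y -> R) (b : R -> R)
    (theta0 theta : R) (y : Y) : R :=
  expR (llr T b theta0 theta y).

Lemma lrE (Y : Type) (R : realType) (T h : Y -> R) (b : R -> R)
    (theta0 theta : R) (y : Y) : h y != 0 ->
  expfam T h b theta y / expfam T h b theta0 y = lr T b theta0 theta y.
Proof.
move=> hy; rewrite /expfam /lr /llr -mulf_div divff// mulr1 -expRN -expRD.
by congr expR; rewrite mulrBl opprB !addrA addrAC; congr (_ + _); rewrite addrAC.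
Qed.

Lemma llrE (Y : Type) (R : realType) (T h : Y -> R) (b : R -> R)
    (theta0 theta : R) (y : Y) : h y != 0 ->
  ln (expfam T h b theta y / expfam T h b theta0 y) = llr T b theta0 theta y.
Proof. by move=> hy; rewrite lrE// expRK. Qed.

(* Conventions: 0 log (0 / q) = 0, and p log (p / 0) = +oo for p > 0. *)
Definition KL d (Y : measurableType d) (R : realType)
    (mu : {measure set Y -> \bar R}) (p q : Y -> R) : \bar R :=
  (\int[mu]_y (if p y == 0%R then 0
               else if q y == 0%R then +oo
               else (ln (p y / q y) * p y)%:E))%E.

(* Differentiability relative to D, hence one-sided at an end point of an
   interval D. *)
Definition differentiable_on (R : realType) (D : set R) (b : R -> R) : Prop :=
  forall x, D x ->
    exists l : R, (b u - b x) / (u - x) @[u --> within D x^'] --> l.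

Definition away (R : realType) (Theta : set R) (theta0 eps : R) : set R :=
  [set theta | Theta theta /\ eps <= `|theta - theta0|].

Definition increasing_away_from (R : realType) (Theta : set R) (theta0 : R)
    (I : R -> \bar R) : Prop :=
  (forall s t, Theta s -> Theta t -> theta0 <= s -> s < t -> (I s < I t)%E) /\
  (forall s t, Theta s -> Theta t -> s <= theta0 -> t < s -> (I s < I t)%E).

(* X 0, X 1, ... are i.i.d. with density g with respect to mu. *)
Definition iid_density d d' (Y : measurableType d) (Omega : measurableType d')
    (R : realType) (mu : {measure set Y -> \bar R}) (P : probability Omega R)
    (X : nat -> Omega -> Y) (g : Y -> R) : Prop :=
  [/\ forall i, measurable_fun setT (X i),
      forall i (B : set Y), measurable B ->
        (P (X i @^-1` B) = \int[mu]_(y in B) (g y)%:E)%E &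
      forall (s : seq nat) (B : nat -> set Y), uniq s ->
        (forall i, measurable (B i)) ->
        (P (\bigcap_(i in [set` s]) (X i @^-1` B i)) =
          \prod_(i <- s) P (X i @^-1` B i))%E].

(* max_(1 <= k <= m) sup_(theta) sum_(i = k)^m log (f_theta / f_theta0)(Y_i),
   where the observation Y_(i+1) is X i; the window k..m is [k - 1, m[ here. *)
Definition glr_stat (Y Omega : Type) (R : realType) (T : Y -> R) (b : R -> R)
    (Theta : set R) (theta0 eps : R) (X : nat -> Omega -> Y)
    (m : nat) (w : Omega) : \bar R :=
  (\big[maxe/-oo]_(k < m)
     ereal_sup [set (\sum_(k <= i < m) llr T b theta0 theta (X i w))%R%:E
               | theta in away Theta theta0 eps])%E.

(* ereal_inf set0 = +oo *)
Definition tau_G (Y Omega : Type) (R : realType) (T : Y -> R) (b : R -> R)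
    (Theta : set R) (theta0 eps A : R) (X : nat -> Omega -> Y)
    (w : Omega) : \bar R :=
  ereal_inf [set m%:R%:E | m in
    [set m : nat | (1 <= m)%N /\
       (A%:E < glr_stat T b Theta theta0 eps X m w)%E]].

Definition kappa_condition d (Y : measurableType d) (R : realType)
    (mu : {measure set Y -> \bar R}) (T : Y -> R) (b : R -> R)
    (Theta : set R) (theta0 eps : R) (g : Y -> R) (kappa_g : R) : Prop :=
  exists kappa : R -> R,
    [/\ forall theta, away Theta theta0 eps theta ->
          0 < kappa theta /\
          (\int[mu]_y (lr T b theta0 theta y `^ kappa theta * g y)%:E = 1)%E,
        0 < kappa_g &
        kappa_g <= inf [set kappa theta | theta in away Theta theta0 eps]].

(* e^(kappa A) / (2 (A / Imin + 1)), with Imin a priori extended-real. *)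
Definition arl_bound (R : realType) (kappa A : R) (Imin : \bar R) : \bar R :=
  ((expR (kappa * A))%:E / (2%:E * (A%:E / Imin + 1)))%E.

(* Main.v *)
Require Import Defs.
From HB Require Import structures.
From mathcomp Require Import all_boot all_order all_algebra.
From mathcomp Require Import all_classical all_reals all_analysis.
From mathcomp Require Import measurable_realfun ring lra zify.
Import Order.TTheory GRing.Theory Num.Theory.
Import numFieldNormedType.Exports.
Local Open Scope classical_set_scope.
Local Open Scope ring_scope.
Set Implicit Arguments.
Unset Strict Implicit.
Unset Printing Implicit Defensive.

(* Say that a window [k, m[ of observations crosses if its log-likelihood ratio
   exceeds A for some theta with |theta - theta0| >= eps, and let alpha bound,
   for every k, the probability that some window starting at k crosses.  At the
   alarm time tau some window starting at a k < tau crosses; since {k < tau}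
   only depends on the first k observations, it is independent of the windows
   starting at k, so 1 <= sum_k P(k < tau) alpha = alpha E[tau].

   It remains to see that alpha = 2 (A / Imin + 1) e^(- kappa A) works.  Treat
   the two sides of theta0 separately.  For a fixed theta, the maximal inequality
   for the supermartingale exp (kappa_theta * log-likelihood ratio) bounds the
   probability of ever crossing by e^(- kappa A).  For a fixed window, the
   crossing events of the various theta are half-lines for the sum of the T(Y_i),
   hence nested, and their union obeys the same bound; this is used for the at
   most A / Imin lengths n with n Imin < A.  On longer windows, nonnegativity of
   the Kullback-Leibler divergence shows that crossing for some theta implies
   crossing for theta0 +- eps. *)

(** * Independence and joint laws *)

Section independence.
Context {d'} {Omega : measurableType d'} {R : realType}.
Variable P : probability Omega R.
Local Open Scope ereal_scope.

(** With [F] fixed, both sides are finite measures in [E]: the restriction of [P] to [F], and [P]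
    scaled by [P F]. They agree on the pi-system [G] and have the same total mass, hence agree on
    the generated sigma-algebra. *)
Lemma indep_sigma_algebral (G : set (set Omega)) (F : set Omega) :
  setI_closed G -> G `<=` measurable -> measurable F ->
  (forall E, G E -> P (E `&` F) = P E * P F) ->
  forall E, <<s G >> E -> P (E `&` F) = P E * P F.
Proof.
move=> GI Gm mF GF E.
pose c := fine (P F).
have c0 : (0 <= c)%R by exact: fine_ge0.
have cE : c%:E = P F by rewrite /c fineK// fin_num_measure.
pose m1 : {measure set Omega -> \bar R} := mrestr P mF.
pose m2 : {measure set Omega -> \bar R} := mscale (NngNum c0) P.
have m1E A : m1 A = P (A `&` F) by [].
have m2E A : m2 A = P A * P F by rewrite -cE muleC.
have GT : [set X | G X /\ X `<=` setT] = G.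
  by apply/seteqP; split => [X []//|X GX]; split.
have := @g_sigma_algebra_measure_unique_trace _ _ _ G setT measurableT.
rewrite GT => /(_ R Gm GI m1 m2) h GE; rewrite -m1E -m2E; apply: h => //=.
- by rewrite m1E m2E setTI probability_setT mul1e.
- by move=> A GA; rewrite m1E m2E GF.
- by rewrite m1E setTI (le_lt_trans (probability_le1 _ _)) ?ltry.
Qed.

Lemma indep_sigma_algebra (G H : set (set Omega)) :
  setI_closed G -> setI_closed H -> G `<=` measurable -> H `<=` measurable ->
  (forall E F, G E -> H F -> P (E `&` F) = P E * P F) ->
  forall E F, <<s G >> E -> <<s H >> F -> P (E `&` F) = P E * P F.
Proof.
move=> GI HI Gm Hm GH E F GE HF.
have mE : measurable E.
  by move: E GE; apply: smallest_sub => //; exact: sigma_algebra_measurable.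
rewrite setIC muleC; apply: (indep_sigma_algebral HI Hm mE) HF => F' HF'.
rewrite setIC muleC; apply: (indep_sigma_algebral GI Gm (Hm _ HF')) GE.
by move=> E' /GH; exact.
Qed.

(** The rectangle condition identifies the law of [(U, V)] with the product of the two laws;
    Tonelli's theorem then gives the iterated integral. *)
Lemma ge0_integral_indep {d1 d2} {T1 : measurableType d1} {T2 : measurableType d2}
    (U : Omega -> T1) (V : Omega -> T2) (f : T1 * T2 -> \bar R) :
  measurable_fun setT U -> measurable_fun setT V -> measurable_fun [set: T1 * T2] f ->
  (forall z, 0 <= f z) ->
  (forall A B, measurable A -> measurable B ->
    P (U @^-1` A `&` V @^-1` B) = P (U @^-1` A) * P (V @^-1` B)) ->
  \int[P]_w f (U w, V w) = \int[P]_w \int[P]_w' f (U w, V w').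
Proof.
move=> mU mV mf f0 UV.
have mUV : measurable_fun setT (fun w => (U w, V w)) by exact/measurable_fun_pairP.
pose U' : {mfun Omega >-> T1} := HB.pack U (isMeasurableFun.Build _ _ _ _ _ mU).
pose V' : {mfun Omega >-> T2} := HB.pack V (isMeasurableFun.Build _ _ _ _ _ mV).
pose W' : {mfun Omega >-> (T1 * T2)%type} :=
  HB.pack (fun w => (U w, V w)) (isMeasurableFun.Build _ _ _ _ _ mUV).
have PW X : measurable X ->
    (distribution P U' \x distribution P V') X = distribution P W' X.
  move=> mX; apply: product_measure_unique (mX) => A B mA mB.
  exact: (UV A B mA mB).
transitivity (\int[distribution P W']_z f z).
  by rewrite ge0_integral_distribution.
transitivity (\int[(distribution P U' \x distribution P V')%E]_z f z).
  by apply: eq_measure_integral => X mX _; apply/esym; exact: PW.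
transitivity (\int[distribution P U']_x \int[distribution P V']_y f (x, y)).
  exact: fubini_tonelli1.
rewrite ge0_integral_distribution.
- apply: eq_integral => w _ /=; rewrite ge0_integral_distribution//.
  exact: measurableT_comp.
- exact: measurable_fun_fubini_tonelli_F.
- by move=> x; apply: integral_ge0.
Qed.
End independence.

(** The integral of a nonnegative function is a supremum over the simple functions below it, and a
    larger function has more of them. This serves in particular for [alarm_time], whose
    measurability is not established. *)
Lemma ge0_le_integral_nonmeasurable {d} {T : measurableType d} {R : realType}
    (mu : {measure set T -> \bar R}) (f g : T -> \bar R) :
  (forall x, 0 <= f x)%E -> (forall x, f x <= g x)%E ->
  (\int[mu]_x f x <= \int[mu]_x g x)%E.
Proof.
move=> f0 fg; have g0 x : (0 <= g x)%E by exact: le_trans (f0 x) (fg x).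
rewrite !ge0_integralTE//; apply: le_ereal_sup => _ [s sf <-].
by exists s => // x; exact: le_trans (sf x) (fg x).
Qed.

(** * Blocks of observations and the maximal inequality *)

Section blocks.
Context {d d'} {Y : measurableType d} {Omega : measurableType d'}.
Variable X : nat -> Omega -> Y.

(** A pi-system of cylinders; what matters is the sigma-algebra it generates, that of the
    observations with index in [m, n[. *)
Definition block (m n : nat) : set (set Omega) :=
  [set E | exists B : nat -> set Y, (forall i, measurable (B i)) /\
     E = \bigcap_(i in [set` index_iota m n]) (X i @^-1` B i)].

Lemma block_setI m n : setI_closed (block m n).
Proof.
move=> _ _ [B [mB ->]] [C [mC ->]]; exists (fun i => B i `&` C i).
by split; [move=> i; exact: measurableI|rewrite -bigcapI].
Qed.

Lemma measurable_blockX m n i : (m <= i < n)%N ->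
  measurable_fun setT (X i : g_sigma_algebraType (block m n) -> Y).
Proof.
move=> min _ B mB; rewrite setTI; apply: sub_sigma_algebra.
exists (fun j => if j == i then B else setT); split; first by move=> j; case: ifP.
apply/seteqP; split => [w Bw j /= _|w /(_ i)/=].
  by rewrite /preimage/=; case: eqP => [->|].
by rewrite /preimage/= eqxx; apply; rewrite mem_index_iota.
Qed.

Hypothesis mX : forall i, measurable_fun setT (X i).

Lemma block_measurable m n : block m n `<=` measurable.
Proof.
move=> _ [B [mB ->]]; apply: fin_bigcap_measurable => // i _.
by rewrite -[_ @^-1` _]setTI; exact: mX.
Qed.

Lemma sigma_block_measurable m n : <<s block m n >> `<=` measurable.
Proof.
by apply: smallest_sub; [exact: sigma_algebra_measurable|exact: block_measurable].
Qed.

Lemma measurable_fun_block {d1} {T1 : measurableType d1} m n (f : Omega -> T1) :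
  measurable_fun setT (f : g_sigma_algebraType (block m n) -> T1) ->
  measurable_fun setT f.
Proof. by move=> mf _ B mB; apply: sigma_block_measurable; exact: mf. Qed.

Lemma measurable_block_sum {R : realType} (l : Y -> R) m n p q :
  measurable_fun setT l -> (m <= p)%N -> (q <= n)%N ->
  measurable_fun setT ((fun w => \sum_(p <= i < q) l (X i w)) :
    g_sigma_algebraType (block m n) -> R).
Proof.
move=> ml mp qn.
(* The summands outside the window are set to 0, so that every summand, whatever its index, is
   measurable for the block. *)
rewrite (_ : (fun _ => _) = (fun w => \sum_(i <- index_iota p q)
    (if (p <= i < q)%N then l (X i w) else 0))); last first.
  by apply/funext => w; rewrite big_nat_cond big_mkcond; apply: eq_bigr => i _; rewrite andbT.
apply: measurable_sum => i; have [/andP[pi iq]|_] := boolP (p <= i < q)%N; last by [].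
apply: measurableT_comp => //; apply: measurable_blockX.
by rewrite (leq_trans mp)//= (leq_trans iq).
Qed.

Context {R : realType}.
Variable P : probability Omega R.
Hypothesis indepX : forall (s : seq nat) (B : nat -> set Y), uniq s ->
  (forall i, measurable (B i)) ->
  (P (\bigcap_(i in [set` s]) (X i @^-1` B i)) =
    \prod_(i <- s) P (X i @^-1` B i))%E.

(** It suffices to treat cylinders. Two cylinders over adjacent blocks form one cylinder over [m,
    p[, whose probability is a product that splits at [n]. *)
Lemma indep_blocks m n p E F : (m <= n)%N -> (n <= p)%N ->
  <<s block m n >> E -> <<s block n p >> F ->
  P (E `&` F) = (P E * P F)%E.
Proof.
move=> mn np; apply: indep_sigma_algebra; try exact: block_setI;
  try exact: block_measurable.
move=> _ _ [B [mB ->]] [C [mC ->]].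
pose D i := if (i < n)%N then B i else C i.
have mD i : measurable (D i) by rewrite /D; case: ifP.
have DB i : i \in index_iota m n -> D i = B i.
  by rewrite mem_index_iota /D => /andP[_ ->].
have DC i : i \in index_iota n p -> D i = C i.
  by rewrite mem_index_iota /D => /andP[ni _]; rewrite ltnNge ni.
have -> : \bigcap_(i in [set` index_iota m n]) (X i @^-1` B i) =
    \bigcap_(i in [set` index_iota m n]) (X i @^-1` D i).
  by apply: eq_bigcapr => i /= /DB ->.
have -> : \bigcap_(i in [set` index_iota n p]) (X i @^-1` C i) =
    \bigcap_(i in [set` index_iota n p]) (X i @^-1` D i).
  by apply: eq_bigcapr => i /= /DC ->.
have mnp : index_iota m p = index_iota m n ++ index_iota n p.
  rewrite /index_iota.
  have -> : (p - m = (n - m) + (p - n))%N by rewrite addnC addnBA// subnK.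
  by rewrite iotaD subnKC.
have -> : \bigcap_(i in [set` index_iota m n]) (X i @^-1` D i) `&`
    \bigcap_(i in [set` index_iota n p]) (X i @^-1` D i) =
    \bigcap_(i in [set` index_iota m p]) (X i @^-1` D i).
  rewrite -bigcap_setU; congr bigcap; rewrite mnp; apply/seteqP.
  by split => i /=; rewrite mem_cat => /orP.
by rewrite !indepX ?iota_uniq// mnp big_cat.
Qed.

Local Open Scope ereal_scope.

(* The partial sums are frozen once they exceed [a]: their exponential is then a
   supermartingale which is larger than [expR a] exactly when the level [a] has
   been crossed. *)
Fixpoint stopped_sum (l : Y -> R) (a : R) (k n : nat) (w : Omega) : R :=
  if n is n'.+1 then
    let v := stopped_sum l a k n' w in
    (if (a < v)%R then v else v + l (X (k + n') w))%R
  else 0%R.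

(** Until the level is first exceeded the stopped sum is the ordinary partial sum; once above [a] it
    stays there. *)
Lemma stopped_sum_cross l a k M w :
  (exists n, (k < n <= k + M)%N /\ (a < \sum_(k <= i < n) l (X i w))%R) ->
  (a < stopped_sum l a k M w)%R.
Proof.
have S n : (stopped_sum l a k n w <= a)%R ->
    stopped_sum l a k n w = (\sum_(k <= i < k + n) l (X i w))%R.
  elim: n => [|n IH] /=; first by rewrite addn0 big_geq.
  case: ltP => [an|na _]; first by rewrite leNgt an.
  by rewrite IH// addnS big_nat_recr ?leq_addr.
have up n m : (a < stopped_sum l a k n w)%R -> (a < stopped_sum l a k (n + m) w)%R.
  by move=> an; elim: m => [|m IH]; rewrite ?addn0// addnS /= IH.
move=> [n [/andP[kn nM] an]].
rewrite -(subnKC (_ : n - k <= M)%N); last by rewrite leq_subLR.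
apply: up; rewrite ltNge; apply/negP => /[dup] /S {1}->.
by rewrite subnKC ?(ltnW kn)// leNgt an.
Qed.

Lemma measurable_stopped_sum l a k n p : measurable_fun setT l -> (k + n <= p)%N ->
  measurable_fun setT (stopped_sum l a k n : g_sigma_algebraType (block k p) -> R).
Proof.
move=> ml; elim: n => [|n IH] /= np; first exact: measurable_cst.
have {}IH : measurable_fun setT (stopped_sum l a k n : g_sigma_algebraType (block k p) -> R).
  by apply: IH; rewrite (leq_trans _ np)// leq_add2l.
apply: measurable_fun_ifT => //; first exact: measurable_fun_ltr.
apply: measurable_funD => //; apply: measurableT_comp => //.
by apply: measurable_blockX; rewrite leq_addr -addnS.
Qed.

(** Induction on [n]: the new observation is independent of the past, so it can be integrated first.
    It contributes a factor 1 on frozen paths and at most 1 on the others. *)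
Lemma expR_stopped_sum_le1 l a k n : measurable_fun setT l ->
  (forall i, \int[P]_w (expR (l (X i w)))%:E <= 1) ->
  \int[P]_w (expR (stopped_sum l a k n w))%:E <= 1.
Proof.
move=> ml lX; elim: n => [|n IH] /=.
  by rewrite expR0 integral_cst//= probability_setT mul1e.
apply: le_trans IH.
pose f (z : R * Y) : \bar R := (expR (if (a < z.1)%R then z.1 else z.1 + l z.2)%R)%:E.
have mf : measurable_fun [set: R * Y] f.
  apply/measurable_EFinP; apply: measurableT_comp => //.
  apply: measurable_fun_ifT => //; first exact: measurable_fun_ltr.
  by apply: measurable_funD => //; exact: measurableT_comp.
have mS := measurable_stopped_sum a ml (leqnn (k + n)).
rewrite (ge0_integral_indep (P := P) (U := stopped_sum l a k n) (V := X (k + n)) (f := f))//.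
- apply: ge0_le_integral_nonmeasurable => w.
    by apply: integral_ge0 => w' _; rewrite lee_fin expR_ge0.
  rewrite /f /=; have [_|_] := boolP (a < stopped_sum l a k n w)%R.
    by rewrite integral_cst//= probability_setT mule1.
  under eq_integral do rewrite expRD EFinM.
  rewrite ge0_integralZl ?lee_fin ?expR_ge0//.
  + by rewrite -[leRHS]mule1 lee_wpmul2l ?lee_fin ?expR_ge0.
  + apply/measurable_EFinP; apply: measurableT_comp => //.
    exact: (measurableT_comp ml (mX _)).
- exact: measurable_fun_block mS.
- by move=> z; rewrite lee_fin expR_ge0.
- move=> A B mA mB; apply: (indep_blocks (leq_addr n k) (leqnSn _)).
    by rewrite -[_ @^-1` _]setTI; exact: mS.
  by rewrite -[_ @^-1` _]setTI; apply: measurable_blockX; rewrite //= leqnn /=.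
Qed.

(** By [stopped_sum_cross] the stopped sum at horizon [M] is at least [a] on [E]; the exponential
    Markov inequality then gives a bound free of [M]. *)
Lemma maximal_inequality l a k M E : measurable_fun setT l ->
  (forall i, \int[P]_w (expR (l (X i w)))%:E <= 1) ->
  measurable E ->
  E `<=` [set w | exists n, (k < n <= k + M)%N /\
                            (a < \sum_(k <= i < n) l (X i w))%R] ->
  P E <= (expR (- a))%:E.
Proof.
move=> ml lX mE EA.
have mS : measurable_fun setT (stopped_sum l a k M).
  by apply: measurable_fun_block; exact: measurable_stopped_sum (leqnn _).
pose S : {mfun Omega >-> R} :=
  HB.pack (stopped_sum l a k M) (isMeasurableFun.Build _ _ _ _ _ mS).
apply: (@le_trans _ _ (P [set w | a <= S w]%R)).
  apply: le_measure; rewrite ?inE//.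
    by rewrite -[X in measurable X]setTI; exact: measurable_fun_le.
  by move=> w /EA /stopped_sum_cross /ltW.
apply: (le_trans (chernoff S a ltr01)).
rewrite mul1r -[leRHS]mul1e lee_wpmul2r ?lee_fin ?expR_ge0//.
rewrite (le_trans _ (expR_stopped_sum_le1 a k M ml lX))// /mmt_gen_fun unlock.
by under eq_integral do rewrite /= mulr1.
Qed.
End blocks.

(** * Expectations under a law with a density *)

Section law_with_density.
Import HBNNSimple.

(** The left-hand integral is a supremum over simple functions below [phi], and for these the
    density formula for probabilities applies on each level set. *)
Lemma ge0_integral_law_le {d d'} {Y : measurableType d} {Omega : measurableType d'}
    {R : realType} (mu : {measure set Y -> \bar R}) (P : probability Omega R)
    (X : Omega -> Y) (g phi : Y -> R) :
  measurable_fun setT X -> measurable_fun setT g -> (forall y, 0 <= g y) ->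
  (forall B, measurable B -> P (X @^-1` B) = \int[mu]_(y in B) (g y)%:E)%E ->
  measurable_fun setT phi -> (forall y, 0 <= phi y) ->
  (\int[P]_w (phi (X w))%:E <= \int[mu]_y (phi y * g y)%:E)%E.
Proof.
move=> mX mg g0 Xg mphi phi0.
pose X' : {mfun Omega >-> Y} := HB.pack X (isMeasurableFun.Build _ _ _ _ _ mX).
have -> : (\int[P]_w (phi (X w))%:E = \int[distribution P X']_y (phi y)%:E)%E.
  by rewrite (ge0_integral_distribution X' (f := EFin \o phi))//; exact/measurable_EFinP.
rewrite [leLHS]ge0_integralTE; last by move=> y; rewrite lee_fin.
apply: ge_ereal_sup => _ [s sphi <-].
have : (\int[mu]_y (s y * g y)%:E <= \int[mu]_y (phi y * g y)%:E)%E.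
  apply: ge0_le_integral_nonmeasurable => y; rewrite lee_fin.
    by rewrite mulr_ge0.
  by rewrite ler_wpM2r// -lee_fin.
apply: le_trans.
have sE y : s y * g y = \sum_(x \in range s) (x * (g y * \1_(s @^-1` [set x]) y)).
  rewrite {1}fimfunE mulr_fsuml; apply: eq_fsbigr => x _.
  by rewrite -mulrA (mulrC (g y)).
under eq_integral do rewrite sE -fsumEFin//.
have ms x : measurable (s @^-1` [set x]) by rewrite -[_ @^-1` _]setTI; exact: measurable_funP.
have mgs x : measurable_fun setT (fun y => g y * \1_(s @^-1` [set x]) y).
  by apply: measurable_funM => //; exact: measurable_indic.
have gs0 x y : 0 <= g y * \1_(s @^-1` [set x]) y by rewrite mulr_ge0.
rewrite ge0_integral_fsum//; last 2 first.
- by move=> x; apply/measurable_EFinP; exact: measurable_funM.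
(* Either [x] is the value of [s] at [y], hence nonnegative, or the indicator vanishes. *)
- move=> x y _; rewrite lee_fin; have [xs|xs] := boolP (s y == x).
    by rewrite mulr_ge0// -(eqP xs).
  by rewrite indicE memNset ?mulr0//= => /eqP; exact/negP.
rewrite sintegralE le_eqVlt; apply/orP; left; apply/eqP.
apply: eq_fsbigr => x /[!inE] -[y _ <-].
under eq_integral do rewrite EFinM.
rewrite ge0_integralZl//; last 3 first.
- exact/measurable_EFinP.
- by move=> z _; rewrite lee_fin.
- by rewrite lee_fin.
congr (_ * _)%E; rewrite /= /distribution /pushforward Xg// integral_mkcond.
apply: eq_integral => z _; rewrite patchE indicE.
by case: ifPn => _; rewrite ?mulr1 ?mulr0.
Qed.

End law_with_density.

(** * Kullback-Leibler divergence in the exponential family *)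

Section exponential_family.
Context {d} {Y : measurableType d} {R : realType}.
Variable mu : {measure set Y -> \bar R}.
Variables (T h : Y -> R) (b : R -> R).
Hypothesis mT : measurable_fun setT T.
Hypothesis h_ge0 : forall y, 0 <= h y.
Local Notation f := (expfam T h b).
Local Notation I theta theta0 := (KL mu (f theta) (f theta0)).

Lemma expfam_ge0 theta y : 0 <= f theta y.
Proof. by rewrite mulr_ge0 ?expR_ge0. Qed.

Lemma measurable_llr theta0 theta : measurable_fun setT (llr T b theta0 theta).
Proof.
apply: measurable_funD => //; apply: measurable_funB => //.
exact: measurable_funM.
Qed.

Lemma expfam_llr theta0 theta y :
  f theta y = expR (llr T b theta0 theta y) * f theta0 y.
Proof.
rewrite /expfam /llr mulrA -expRD; congr (expR _ * _); ring.
Qed.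

Lemma KL_expfam theta0 theta : I theta theta0 =
  (\int[mu]_y (llr T b theta0 theta y * f theta y)%:E)%E.
Proof.
apply: eq_integral => y _; have [h0|h0] := eqVneq (h y) 0.
  by rewrite /expfam h0 !mulr0 eqxx.
have p0 t : f t y != 0 by rewrite mulf_neq0// lt0r_neq0// expR_gt0.
by rewrite !(negbTE (p0 _)) llrE.
Qed.

Lemma KL_expfam_refl theta : I theta theta = 0%E.
Proof.
rewrite KL_expfam; under eq_integral do rewrite /llr subrr mul0r sub0r addNr mul0r.
exact: integral0.
Qed.

(* [KL f_theta1 f_theta >= 0] rewritten as a bound on [KL f_theta1 f_theta0];
   it replaces the convexity inequality
   [b theta >= b theta1 + (theta - theta1) * b' theta1], so that no derivative
   of [b] is needed. *)
Lemma KL_expfam_le theta0 theta1 lam (theta := theta1 + lam * (theta1 - theta0)) :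
  0 < lam -> is_density mu (f theta0) -> is_density mu (f theta1) ->
  is_density mu (f theta) ->
  (lam%:E * I theta1 theta0 <=
    (b theta - b theta0 - (1 + lam) * (b theta1 - b theta0))%:E)%E.
Proof.
move=> lam0 [m0 p0 i0] [m1 p1 i1] [m2 p2 i2].
pose c := b theta - b theta1 - lam * (b theta1 - b theta0).
pose l := llr T b theta0 theta1.
have int t : measurable_fun setT (f t) -> (\int[mu]_y (f t y)%:E = 1)%E ->
    mu.-integrable setT (EFin \o f t).
  move=> mt it; apply/integrableP; split; first exact/measurable_EFinP.
  under eq_integral do rewrite /= ger0_norm ?expfam_ge0//.
  by rewrite it ltry.
(* The log-likelihood ratio of [theta] against [theta1] is [lam * l - c]. Put into 1 + x <= exp x
   and multiplied by the density at [theta1], it gives a bound whose right side integrates to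
   [c]. *)
have upper y : lam * (l y * f theta1 y) <= f theta y - f theta1 y + c * f theta1 y.
  have := expR_ge1Dx (llr T b theta1 theta y).
  rewrite (expfam_llr theta1 theta) => /(ler_wpM2r (expfam_ge0 theta1 y)).
  by rewrite /l /llr /c /theta; nra.
(* The same inequality for [theta0] against [theta1], where the log-ratio is [- l]. Together the two
   bounds dominate the integrand of the divergence, which is therefore integrable. *)
have lower y : f theta1 y - f theta0 y <= l y * f theta1 y.
  have := expR_ge1Dx (llr T b theta1 theta0 y).
  rewrite (expfam_llr theta1 theta0) => /(ler_wpM2r (expfam_ge0 theta1 y)).
  by rewrite /l /llr; nra.
have int1 := int _ m1 i1; have int0 := int _ m0 i0; have int2 := int _ m2 i2.
have intu : mu.-integrable setT
    (fun y => (f theta y - f theta1 y + c * f theta1 y)%:E).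
  exact: (integrableD measurableT (integrableB measurableT int2 int1) (integrableZl measurableT c int1)).
have inti : mu.-integrable setT (fun y => (l y * f theta1 y)%:E).
  apply: (@le_integrable _ _ _ mu setT measurableT _
      (fun y => (lam^-1 * `|f theta y - f theta1 y + c * f theta1 y| +
                 `|f theta1 y - f theta0 y|)%:E)).
  - apply/measurable_EFinP; apply: measurable_funM => //.
    exact: measurable_llr.
  - move=> y _; rewrite /= lee_fin [leRHS]ger0_norm; last first.
      by apply: addr_ge0 => //; apply: mulr_ge0 => //; rewrite invr_ge0 ltW.
    have [ly|ly] := leP 0 (l y * f theta1 y).
      rewrite ger0_norm// ler_wpDr// ler_pdivlMl//.
      exact: le_trans (upper y) (ler_norm _).
    rewrite ltr0_norm// ler_wpDl//; first by apply: mulr_ge0 => //; rewrite invr_ge0 ltW.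
    rewrite -normrN ler_normr lerN2 lower; lra.
  - apply: (@integrableD _ _ _ mu setT measurableT
      (fun y => (lam^-1 * `|f theta y - f theta1 y + c * f theta1 y|)%:E)
      (fun y => `|f theta1 y - f theta0 y|%:E)).
      exact: (integrableZl measurableT _ (integrable_abse intu)).
    exact: (integrable_abse (integrableB measurableT int1 int0)).
rewrite KL_expfam -integralZl//.
apply: (@le_trans _ _ (\int[mu]_y (f theta y - f theta1 y + c * f theta1 y)%:E)%E).
  apply: le_integral => //; first exact: (integrableZl measurableT lam inti).
  by move=> y _; rewrite -EFinM lee_fin.
rewrite (integralD measurableT (integrableB measurableT int2 int1)
  (integrableZl measurableT c int1)) /=.
rewrite (integralB measurableT int2 int1) (integralZl measurableT int1) /=.
by rewrite i1 i2 subee// add0e mule1 lee_fin /c; lra.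
Qed.
End exponential_family.

(* The half-lines form a chain, so their union is the limit of an increasing
   sequence of them: no supremum has to be attained. *)
Lemma measure_exists_lt_le {d} {Omega : measurableType d} {R : realType}
    (P : {measure set Omega -> \bar R}) (Z : Omega -> R) (C : set R) (p : \bar R) :
  measurable_fun setT Z -> (0 <= p)%E ->
  (forall c, C c -> P [set w | (c < Z w)%R] <= p)%E ->
  (P [set w | exists c, C c /\ (c < Z w)%R] <= p)%E.
Proof.
move=> mZ p0 Cp; have [->|C0] := eqVneq C set0.
  by rewrite (_ : [set _ | _] = set0) ?measure0// -subset0 => w [c []].
have mlt c : measurable [set w | c < Z w].
  by rewrite -[X in measurable X]setTI; exact: measurable_fun_ltr.
(* [t] decreases to the infimum of [C], or to minus infinity when [C] has no lower bound. Each [t i]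
   lies above a point of [C], so its half-line is inside one of the given half-lines. *)
have [t [nt tC Ct]] : exists t : nat -> R, [/\ forall i j, (i <= j)%N -> t j <= t i,
    forall i, exists2 c, C c & c <= t i & forall c, C c -> forall x, c < x ->
    exists i, t i < x].
  have [Clb|Clb] := pselect (has_lbound C).
    have Ci : has_inf C by split => //; exact/set0P.
    exists (fun i => inf C + i.+1%:R^-1); split.
    - by move=> i j ij; rewrite lerD2l lef_pV2 ?posrE// ler_nat.
    - move=> i; have [|c Cc cle] := @inf_adherent _ C (i.+1%:R^-1) _ Ci => //.
      by exists c => //; exact: ltW.
    - move=> c Cc x cx; have xi : 0 < x - inf C.
        by rewrite subr_gt0 (le_lt_trans _ cx)// ge_inf.
      exists (Num.truncn (x - inf C)^-1); rewrite -ltrBrDl.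
      rewrite invf_plt ?posrE//; exact: truncnS_gt.
  exists (fun i => - i%:R); split.
  - by move=> i j ij; rewrite lerN2 ler_nat.
  - move=> i; apply: contrapT => nex; apply: Clb; exists (- i%:R) => c Cc.
    by rewrite leNgt; apply/negP => ci; apply: nex; exists c => //; exact: ltW.
  - move=> c Cc x cx; exists (Num.truncn (- x)).+1.
    by rewrite ltrNl; exact: truncnS_gt.
have -> : [set w | exists c, C c /\ c < Z w] = \bigcup_i [set w | t i < Z w].
  apply/seteqP; split => [w [c [Cc cZ]]|w [i _ /= tZ]].
    by have [i ti] := Ct _ Cc _ cZ; exists i.
  by have [c Cc ct] := tC i; exists c; split => //; exact: le_lt_trans tZ.
have cv : P [set w | t i < Z w] @[i --> \oo] --> P (\bigcup_i [set w | t i < Z w]).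
  apply: nondecreasing_cvg_mu => //; first exact: bigcupT_measurable.
  by move=> i j ij; apply/subsetPset => w /=; apply: le_lt_trans; exact: nt.
rewrite -(cvg_lim _ cv)//; apply: lime_le; first by apply/cvg_ex; eexists; exact: cv.
apply: nearW => i; have [c Cc ct] := tC i; apply: le_trans (Cp c Cc).
by apply: le_measure; rewrite ?inE// => w /=; exact: le_lt_trans.
Qed.

(** * Crossing events of a window *)

Section window_crossing.
Context {d d'} {Y : measurableType d} {Omega : measurableType d'} {R : realType}.
Variables (T : Y -> R) (b : R -> R) (theta0 A : R).
Hypothesis mT : measurable_fun setT T.
Variable X : nat -> Omega -> Y.
Local Notation llr_sum theta k m w :=
  (\sum_(k <= i < m) llr T b theta0 theta (X i w)).

Definition crosses (S : set R) (k m : nat) : set Omega :=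
  [set w | exists theta, S theta /\ A < llr_sum theta k m w].

Lemma llr_sumE theta k m w : llr_sum theta k m w =
  (theta - theta0) * (\sum_(k <= i < m) T (X i w)) - (b theta - b theta0) *+ (m - k).
Proof.
rewrite mulr_sumr -sumr_const_nat -sumrB; apply: eq_bigr => i _.
by rewrite /llr; ring.
Qed.

(** The union over theta may be uncountable, but crossing means that the sum of the [T (X i w)] lies
    in a union of open sets, which is open. *)
Lemma crosses_measurable S m n k q : (m <= k)%N -> (q <= n)%N ->
  <<s block X m n >> (crosses S k q).
Proof.
move=> mk qn.
pose D := \bigcup_(theta in S)
  [set s : R | A < (theta - theta0) * s - (b theta - b theta0) *+ (q - k)].
have oD : open D.
  apply: bigcup_open => theta _; 
  apply: (@open_comp _ _ (fun s => (theta - theta0) * s - (b theta - b theta0) *+ (q - k))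
    [set s | A < s]); last exact: open_gt.
  move=> s _; apply: cvgB; last exact: cvg_cst.
  by apply: cvgM; [exact: cvg_cst|exact: cvg_id].
rewrite (_ : crosses S k q = setT `&` (fun w => \sum_(k <= i < q) T (X i w)) @^-1` D).
  by apply: (measurable_block_sum mT mk qn) => //; exact: open_measurable.
apply/seteqP; split => w /=.
  by move=> [theta [St At]]; split => //; exists theta => //=; rewrite -llr_sumE.
by move=> [_ [theta St]] /=; rewrite -llr_sumE => At; exists theta.
Qed.

End window_crossing.

(** * Mean time to the first alarm *)

Section first_alarm.
Context {d d'} {Y : measurableType d} {Omega : measurableType d'} {R : realType}.
Variable X : nat -> Omega -> Y.
Hypothesis mX : forall i, measurable_fun setT (X i).
Variable P : probability Omega R.
Hypothesis indepX : forall (s : seq nat) (B : nat -> set Y), uniq s ->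
  (forall i, measurable (B i)) ->
  (P (\bigcap_(i in [set` s]) (X i @^-1` B i)) =
    \prod_(i <- s) P (X i @^-1` B i))%E.
Variable cross : nat -> nat -> set Omega.
Hypothesis cross_measurable : forall m n k q, (m <= k)%N -> (q <= n)%N ->
  <<s block X m n >> (cross k q).

(** This is the event that the alarm time exceeds [m]. *)
Definition quiet (m : nat) : set Omega :=
  ~` \bigcup_k \bigcup_(n in [set n | (k < n <= m)%N]) cross k n.

(** The horizon [M] keeps the event within finitely many observations; its probability is later
    bounded uniformly in [M]. *)
Definition alarm_from (k M : nat) : set Omega :=
  \bigcup_(n in [set n | (k < n <= k + M)%N]) cross k n.

Definition alarm_time (w : Omega) : \bar R :=
  ereal_inf [set m%:R%:E | m in [set m | exists k, (k < m)%N /\ cross k m w]].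

Lemma quiet_measurable m : <<s block X 0 m >> (quiet m).
Proof.
apply: (@measurableC _ (g_sigma_algebraType (block X 0 m))).
apply: (@bigcupT_measurable _ (g_sigma_algebraType (block X 0 m))) => k.
apply: (@bigcup_measurable _ (g_sigma_algebraType (block X 0 m))) => n /= /andP[_ nm].
exact: cross_measurable.
Qed.

Lemma alarm_from_measurable k M : <<s block X k (k + M) >> (alarm_from k M).
Proof.
apply: (@bigcup_measurable _ (g_sigma_algebraType (block X k (k + M)))) => n /= /andP[_ nm].
exact: cross_measurable.
Qed.

Lemma quietPn m w : ~ quiet m w -> exists k n, (k < n <= m)%N /\ cross k n w.
Proof. by rewrite /quiet /setC/= notK => -[k _ [n nm kn]]; exists k, n. Qed.

Lemma quietP m w k n : quiet m w -> (k < n <= m)%N -> ~ cross k n w.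
Proof. by move=> qm nm kn; apply: qm; exists k => //; exists n. Qed.

Lemma sub_quiet m n : (m <= n)%N -> quiet n `<=` quiet m.
Proof.
move=> mn; apply: subsetC => w [k _ [q /= /andP[kq qm] kqw]]; exists k => //; exists q => //=.
by rewrite kq (leq_trans qm).
Qed.

Let mquiet m : measurable (quiet m).
Proof. exact: (sigma_block_measurable mX (@quiet_measurable m)). Qed.

Let malarm k M : measurable (alarm_from k M).
Proof. exact: (sigma_block_measurable mX (@alarm_from_measurable k M)). Qed.

(* At the first alarm time [n], raised by the window [k, n[, there was no alarm
   up to time [k]. *)
Lemma alarm_sub M :
  ~` quiet M `<=` \big[setU/set0]_(k < M) (quiet k `&` alarm_from k M).
Proof.
move=> w /quietPn[k0 [n0 [/andP[kn0 nM0] cr0]]].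
have ex : exists n, `[< exists k, (k < n)%N /\ cross k n w >].
  by exists n0; apply/asboolP; exists k0.
case: (ex_minnP ex) => n /asboolP[k [kn cr]] nmin.
have nM : (n <= M)%N.
  by apply: leq_trans nM0; apply: nmin; apply/asboolP; exists k0.
rewrite -(bigcup_mkord M (fun k => quiet k `&` alarm_from k M)); exists k; first by rewrite /= (leq_trans kn).
split; last by exists n => //=; rewrite kn (leq_trans nM)// leq_addl.
apply: contrapT => /quietPn[k' [n' [/andP[kn' nk'] cr']]].
have : (n <= n')%N by apply: nmin; apply/asboolP; exists k'.
by rewrite leqNgt (leq_ltn_trans nk').
Qed.

(** A truncated form of E[tau] = sum_k P(k < tau), obtained pointwise: with an alarm at [m], only
    indices k < m can be quiet. *)
Lemma sum_quiet_le M : (\sum_(k < M) P (quiet k) <= \int[P]_w alarm_time w)%E.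
Proof.
rewrite (_ : (\sum_(k < M) P (quiet k) =
    \int[P]_w \sum_(k < M) (\1_(quiet k) w)%:E)%E); last first.
  rewrite ge0_integral_sum//.
  - by apply: eq_bigr => k _; rewrite integral_indic// setIT.
  - by move=> k; apply/measurable_EFinP; exact: measurable_indic.
apply: ge0_le_integral_nonmeasurable => w.
  by apply: sume_ge0 => k _; rewrite lee_fin.
apply: le_ereal_inf_tmp => _ [m [k0 [km cr]] <-].
rewrite sumEFin lee_fin.
apply: (@le_trans _ _ (\sum_(k < M) (nat_of_bool (k < m)%N)%:R)).
  apply: ler_sum => k _; rewrite indicE.
  have [/set_mem qk|] := boolP (w \in quiet k); last by rewrite ler0n.
  rewrite ler_nat lt0b ltnNge; apply/negP => mk.
  by apply: (quietP qk _ cr); rewrite km.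
rewrite -natr_sum ler_nat -(big_mkord xpredT (fun k => nat_of_bool (k < m)%N)).
suff : (\sum_(0 <= k < M) nat_of_bool (k < m) <= minn M m)%N by lia.
by elim: M => [|M IH]; [rewrite big_geq|rewrite big_nat_recr//=; lia].
Qed.

(** Independence and [alarm_sub] give [alarmq]. If the mean were a finite [r] with [alpha * r < 1],
    then [q M] would stay above the positive number [1 - alpha * r], and the partial sums of [q]
    could not remain below [r]. *)
Lemma le_integral_alarm_time (alpha : R) : 0 < alpha ->
  (forall k M, P (alarm_from k M) <= alpha%:E)%E ->
  ((alpha^-1)%:E <= \int[P]_w alarm_time w)%E.
Proof.
move=> a0 Pa; pose q k := fine (P (quiet k)).
have Pq k : P (quiet k) = (q k)%:E by rewrite fineK// fin_num_measure.
have q0 k : 0 <= q k by exact: fine_ge0.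
have qM k M : (k <= M)%N -> q M <= q k.
  move=> kM; rewrite -lee_fin -!Pq; apply: le_measure; rewrite ?inE//.
  exact: sub_quiet.
have alarmq M : 1 - q M <= alpha * \sum_(k < M) q k.
  rewrite -lee_fin EFinB -Pq -probability_setC//.
  apply: (@le_trans _ _ (P (\big[setU/set0]_(k < M) (quiet k `&` alarm_from k M)))).
    apply: le_measure; rewrite ?inE; [exact: measurableC| |exact: alarm_sub].
    by apply: bigsetU_measurable => k _; exact: measurableI.
  apply: (le_trans (Boole_inequality P (A := fun k => quiet k `&` alarm_from k M) _)).
    by move=> k _; exact: measurableI.
  rewrite mulr_sumr -sumEFin; apply: lee_sum => k _.
  rewrite -[leLHS]/(P (quiet k `&` alarm_from k M)).
  rewrite (indep_blocks mX indepX (leq0n k) (leq_addr M k) (@quiet_measurable k)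
    (@alarm_from_measurable k M)).
  by rewrite Pq muleC EFinM lee_wpmul2r// lee_fin.
have := sum_quiet_le; case: (\int[P]_w alarm_time w)%E => [r||] sumq.
- have {}sumq M : \sum_(k < M) q k <= r.
    by rewrite -lee_fin -sumEFin; under eq_bigr do rewrite -Pq; exact: sumq.
  rewrite lee_fin -[leLHS]mul1r ler_pdivrMr// mulrC.
  rewrite leNgt; apply/negP => ar1.
  (* Large enough that [M] times [1 - alpha * r] exceeds [r]. *)
  pose M := (Num.truncn (r / (1 - alpha * r))).+1.
  have r0 : 0 <= r by apply: le_trans (sumq 0%N); rewrite big_ord0.
  have : r < M%:R * (1 - alpha * r).
    by rewrite -ltr_pdivrMr ?subr_gt0//; exact: truncnS_gt.
  have : M%:R * q M <= r.
    apply: le_trans (sumq M); rewrite mulr_natl -[M in _ *+ M]card_ord -sumr_const.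
    by apply: ler_sum => k _; apply: qM; exact: ltnW.
  have : M%:R * (1 - alpha * r) <= M%:R * q M.
    rewrite ler_wpM2l// lerBlDr addrC -lerBlDr (le_trans (alarmq M))//.
    by rewrite ler_wpM2l// ltW.
  lra.
- by rewrite leey.
- by have := sumq 0%N; rewrite big_ord0.
Qed.
End first_alarm.

(** * Probability of an alarm from a fixed start *)

Section alarm_probability.
Context {d d'} {Y : measurableType d} {Omega : measurableType d'} {R : realType}.
Variable mu : {measure set Y -> \bar R}.
Variables (T h : Y -> R) (b : R -> R) (Theta : set R) (theta0 eps A : R).
Hypothesis mT : measurable_fun setT T.
Hypothesis h_ge0 : forall y, 0 <= h y.
Hypothesis f_density : forall theta, Theta theta -> is_density mu (expfam T h b theta).
Hypotheses (eps_gt0 : 0 < eps) (Theta0 : Theta theta0).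
Variable X : nat -> Omega -> Y.
Hypothesis mX : forall i, measurable_fun setT (X i).
Variable P : probability Omega R.
Local Notation llr_sum theta k m w :=
  (\sum_(k <= i < m) llr T b theta0 theta (X i w)).
Local Notation cross S := (crosses T b theta0 A X S).

Let mcross S k m : measurable (cross S k m).
Proof.
apply: (sigma_block_measurable mX (m := k) (n := m)).
exact: crosses_measurable.
Qed.

(** On one side of [theta0], dividing by the positive [sg * (theta - theta0)] turns every crossing
    event into a half-line event for the same variable [Z], so [measure_exists_lt_le] applies. *)
Lemma crosses_chain_le (S : set R) (sg : R) k m (p : \bar R) :
  sg * sg = 1 -> (0 <= p)%E -> (forall theta, S theta -> 0 < sg * (theta - theta0)) ->
  (forall theta, S theta -> P (cross [set theta] k m) <= p)%E ->
  (P (cross S k m) <= p)%E.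
Proof.
move=> sg1 p0 Ssg Sp.
pose c theta := (A + (b theta - b theta0) *+ (m - k)) / (sg * (theta - theta0)).
pose Z w := sg * \sum_(k <= i < m) T (X i w).
have mZ : measurable_fun setT Z.
  apply: measurable_funM => //; apply: (measurable_fun_block mX).
  exact: (measurable_block_sum mT (leqnn k) (leqnn m)).
have cZ theta w : S theta -> (c theta < Z w) = (A < llr_sum theta k m w).
  move=> /Ssg th0; rewrite llr_sumE /c ltr_pdivrMr// ltrBrDr; congr (_ < _).
  by rewrite /Z mulrACA sg1 mul1r mulrC.
have -> : cross S k m = [set w | exists x, (c @` S) x /\ x < Z w].
  apply/seteqP; split => w /=.
    by move=> [theta [St At]]; exists (c theta); rewrite cZ//; split => //; exists theta.
  by move=> [_ [[theta St <-]]]; rewrite cZ// => At; exists theta.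
apply: measure_exists_lt_le => // _ [theta St <-].
apply: le_trans (Sp _ St); rewrite le_eqVlt; apply/orP; left; apply/eqP; congr (P _).
apply/seteqP; split => w /=; first by rewrite cZ// => At; exists theta.
by move=> [_ [-> At]]; rewrite cZ.
Qed.

(** Since theta - theta0 = (1 + lam)(theta1 - theta0), adding the crossing inequality at theta to
    [lam * A] <= (m - k) times the bound of [KL_expfam_le] gives the crossing inequality at [theta1]
    multiplied by [1 + lam]. *)
Lemma long_window_crosses (theta1 lam : R) k m w :
  let theta := theta1 + lam * (theta1 - theta0) in
  0 <= lam -> Theta theta1 -> Theta theta ->
  (A%:E <= (m - k)%:R%:E *
     KL mu (expfam T h b theta1) (expfam T h b theta0))%E ->
  A < llr_sum theta k m w -> A < llr_sum theta1 k m w.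
Proof.
move=> theta; rewrite le_eqVlt => /predU1P[lam0 _ _ _|lam0 th1 th AI].
  by rewrite /theta -lam0 mul0r addr0.
have := KL_expfam_le mT h_ge0 lam0 (f_density Theta0) (f_density th1) (f_density th).
rewrite -/theta => Ile.
have : lam * A <= (m - k)%:R * (b theta - b theta0 - (1 + lam) * (b theta1 - b theta0)).
  rewrite -lee_fin !EFinM.
  apply: (@le_trans _ _ ((m - k)%:R%:E * (lam%:E *
      KL mu (expfam T h b theta1) (expfam T h b theta0)))%E); last first.
    by rewrite lee_wpmul2l// lee_fin.
  by rewrite muleCA lee_wpmul2l// lee_fin ltW.
rewrite !llr_sumE -!(mulr_natl (b _ - b _)) => h1 h2.
have l1 : 0 < 1 + lam by lra.
rewrite -(ltr_pM2l l1); move: h1 h2.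
rewrite (_ : theta - theta0 = (1 + lam) * (theta1 - theta0)); last by rewrite /theta; ring.
by set s := \sum_(_ <= _ < _) _; lra.
Qed.

(** Windows longer than [N] cross only if they cross for the boundary parameter, which costs [p] for
    all of them together; each of the [N] shorter lengths costs [p] by nesting. *)
Lemma alarm_side_le (sg p : R) (N k M : nat)
    (S := [set theta | Theta theta /\ eps <= sg * (theta - theta0)]) :
  sg * sg = 1 -> 0 <= p -> Theta (theta0 + sg * eps) ->
  (forall n, (N < n)%N -> (A%:E <= n%:R%:E *
     KL mu (expfam T h b (theta0 + sg * eps)) (expfam T h b theta0))%E) ->
  (forall theta K, S theta -> P (alarm_from (cross [set theta]) k K) <= p%:E)%E ->
  (P (alarm_from (cross S) k M) <= (N.+1%:R * p)%:E)%E.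
Proof.
move=> sg1 p0 th1 long Sp; set theta1 := theta0 + sg * eps in th1 long.
have malarm S' K : measurable (alarm_from (cross S') k K).
  by apply: bigcup_measurable => n _.
have Sth1 : S theta1.
  by split => //; rewrite /theta1 [theta0 + _]addrC addrK mulrA sg1 mul1r.
pose D j := if j is i.+1 then cross S k (k + i.+1) else alarm_from (cross [set theta1]) k M.
have mD j : measurable (D j) by case: j => [|j]; [exact: malarm|exact: mcross].
have sub : alarm_from (cross S) k M `<=` \big[setU/set0]_(j < N.+1) D j.
  move=> w [n /= /andP[kn nM] [theta [St At]]]; rewrite -bigcup_mkord.
  have [nN|Nn] := leqP (n - k) N.
    exists (n - k)%N; rewrite /= ?ltnS//.
    by rewrite -(prednK (_ : 0 < n - k)%N) ?subn_gt0//= prednK ?subn_gt0// subnKC ?(ltnW kn)//; exists theta.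
  exists 0%N => //=; exists n; first by rewrite /= kn.
  exists theta1; split => //.
  (* [1 + lam] is the distance from [theta] to [theta0] in units of [eps], hence at least 1. *)
  pose lam := sg * (theta - theta0) / eps - 1.
  have thE : theta = theta1 + lam * (theta1 - theta0).
    rewrite /lam /theta1.
    transitivity (theta0 + (sg * sg) * (theta - theta0) * (eps / eps)); last by ring.
    by rewrite sg1 divff ?gt_eqF//; ring.
  have lam0 : 0 <= lam by rewrite subr_ge0 ler_pdivlMr// mul1r; case: St.
  apply: (long_window_crosses lam0 th1) => //; rewrite -?thE//; last exact: long.
  by case: St.
apply: (@le_trans _ _ (P (\big[setU/set0]_(j < N.+1) D j))).
  apply: le_measure; rewrite ?inE//.
  by apply: bigsetU_measurable => j _; exact: mD.
apply: (le_trans (Boole_inequality P (A := D) _)) => //.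
rewrite mulr_natl -[X in _ *+ X](card_ord N.+1) -sumr_const -sumEFin.
apply: lee_sum => i _; case: (nat_of_ord i) => [|j] /=; first exact: Sp.
apply: (crosses_chain_le sg1) => // [theta [_]|theta St].
  exact: lt_le_trans.
apply: le_trans (Sp theta j.+1 St); apply: le_measure; rewrite ?inE//.
by move=> w cw; exists (k + j.+1)%N => //=; rewrite leqnn andbT -addn1 leq_add2l.
Qed.

Lemma alarm_away_le (p : R) (N k M : nat) :
  0 <= p -> Theta (theta0 + eps) -> Theta (theta0 - eps) ->
  (forall n, (N < n)%N -> (A%:E <= n%:R%:E *
     mine (KL mu (expfam T h b (theta0 + eps)) (expfam T h b theta0))
          (KL mu (expfam T h b (theta0 - eps)) (expfam T h b theta0)))%E) ->
  (forall theta K, away Theta theta0 eps theta ->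
     P (alarm_from (cross [set theta]) k K) <= p%:E)%E ->
  (P (alarm_from (cross (away Theta theta0 eps)) k M) <= (2 * N.+1%:R * p)%:E)%E.
Proof.
move=> p0 thp thm long Sp.
pose S sg := [set theta | Theta theta /\ eps <= sg * (theta - theta0)].
have malarm S' K : measurable (alarm_from (cross S') k K).
  by apply: bigcup_measurable => n _.
have side sg : (sg == 1) || (sg == -1) ->
    (P (alarm_from (cross (S sg)) k M) <= (N.+1%:R * p)%:E)%E.
  move=> sgE; apply: alarm_side_le => //.
  - by case/orP: sgE => /eqP ->; rewrite ?mulrNN mul1r.
  - by case/orP: sgE => /eqP ->; rewrite ?mulN1r ?mul1r.
  - move=> n Nn; apply: le_trans (long _ Nn) _; apply: lee_wpmul2l; first by rewrite lee_fin.
    by rewrite ge_min; case/orP: sgE => /eqP ->; rewrite ?mulN1r ?mul1r lexx ?orbT.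
  - move=> theta K [tht et]; apply: Sp; split => //; apply: (le_trans et).
    by case/orP: sgE => /eqP ->; rewrite ?mulN1r ?mul1r ?ler_norm// -normrN ler_norm.
apply: (@le_trans _ _ (P (alarm_from (cross (S 1%R)) k M `|` alarm_from (cross (S (-1)%R)) k M))).
  apply: le_measure; rewrite ?inE//; first exact: measurableU.
  move=> w [n kn [theta [[tht]]]]; rewrite ler_normr => /orP[et|et] At; [left|right];
    by exists n => //; exists theta; split => //; split => //; rewrite ?mulN1r ?mul1r.
apply: (le_trans (measureU2 _ _ _)) => //.
rewrite -mulrA mulr_natl mulr2n EFinD; apply: leeD; apply: side; rewrite eqxx ?orbT//.
Qed.

End alarm_probability.

(** * Passage to [tau_G] and the final bound *)

Lemma lt_bigmaxe {R : realType} (x : \bar R) (F : nat -> \bar R) (m : nat) :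
  (-oo < x)%E ->
  (x < \big[maxe/-oo]_(k < m) F k)%E <-> exists k, (k < m)%N /\ (x < F k)%E.
Proof.
move=> x0; elim: m => [|m IH].
  by rewrite big_ord0; split => [|[k []//]]; rewrite ltNge leNye.
rewrite big_ord_recr /= lt_max; split.
  move=> /orP[/IH[k [km xF]]|xF]; last by exists m.
  by exists k; split => //; exact: ltnW.
move=> [k []]; rewrite ltnS leq_eqVlt => /predU1P[-> -> //|km xF]; first by rewrite orbT.
by apply/orP; left; apply/IH; exists k.
Qed.

(** A maximum or supremum strictly exceeds [A] exactly when one of its members does; with a strict
    threshold, attainment is irrelevant. *)
Lemma tau_GE {d d'} {Y : measurableType d} {Omega : measurableType d'} {R : realType} (T : Y -> R) (b : R -> R)
    (Theta : set R) (theta0 eps A : R) (X : nat -> Omega -> Y) :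
  tau_G T b Theta theta0 eps A X =
  alarm_time (crosses T b theta0 A X (away Theta theta0 eps)).
Proof.
apply/funext => w; congr (ereal_inf [set _ | _ in _]).
apply/seteqP; split => m; rewrite /= /glr_stat.
  move=> [m0 /(lt_bigmaxe (fun k => ereal_sup [set (\sum_(k <= i < m)
    llr T b theta0 theta (X i w))%:E | theta in _]) m (ltNyr A))[k [km]]].
  move=> /ereal_sup_gt[_ [theta St <-] At].
  by exists k; split => //; exists theta; split.
move=> [k [km [theta [St At]]]]; split; first exact: leq_trans km.
apply/(lt_bigmaxe (fun k => ereal_sup [set (\sum_(k <= i < m)
    llr T b theta0 theta (X i w))%:E | theta in _]) m (ltNyr A)).
exists k; split => //.
apply: (@lt_le_trans _ _ (\sum_(k <= i < m) llr T b theta0 theta (X i w))%:E) => //.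
by apply: ereal_sup_ubound; exists theta.
Qed.

Theorem theorem4p2 (R : realType) (d : measure_display) (Y : measurableType d)
    (mu : {sigma_finite_measure set Y -> \bar R})
    (T h : Y -> R) (b : R -> R) (Theta : set R) (theta0 eps A : R)
    (mT : measurable_fun setT T) (mh : measurable_fun setT h)
    (h_ge0 : forall y, 0 <= h y)
    (Theta_itv : is_interval Theta)
    (f_density : forall theta, Theta theta -> is_density mu (expfam T h b theta))
    (b_diff : differentiable_on Theta b)
    (eps_gt0 : 0 < eps) (Theta0 : Theta theta0)
    (Theta0p : Theta (theta0 + eps)) (Theta0m : Theta (theta0 - eps))
    (A_gt0 : 0 < A) :
  let I theta := KL mu (expfam T h b theta) (expfam T h b theta0) in
  let Imin := mine (I (theta0 + eps)) (I (theta0 - eps)) in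
  increasing_away_from Theta theta0 I ->
  (forall (g : Y -> R) (kappa_g : R),
    is_density mu g ->
    kappa_condition mu T b Theta theta0 eps g kappa_g ->
    forall (d' : measure_display) (Omega : measurableType d')
      (P : probability Omega R) (X : nat -> Omega -> Y),
      iid_density mu P X g ->
      (arl_bound kappa_g A Imin <=
        \int[P]_w tau_G T b Theta theta0 eps A X w)%E)
  /\
  (forall (G : set (Y -> R)) (kappa : (Y -> R) -> R) (kappa_star : R),
    (forall g, G g -> is_density mu g) ->
    (forall g, G g ->
      kappa_condition mu T b Theta theta0 eps g (kappa g)) ->
    0 < kappa_star ->
    (forall g, G g -> kappa_star <= kappa g) ->
    forall g, G g ->
    forall (d' : measure_display) (Omega : measurableType d')
      (P : probability Omega R) (X : nat -> Omega -> Y),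
      iid_density mu P X g ->
      (arl_bound kappa_star A Imin <=
        \int[P]_w tau_G T b Theta theta0 eps A X w)%E).
Proof.
move=> I Imin [incp incm].
have part1 (g : Y -> R) (kappa_g : R) : is_density mu g ->
    kappa_condition mu T b Theta theta0 eps g kappa_g ->
    forall (d' : measure_display) (Omega : measurableType d')
      (P : probability Omega R) (X : nat -> Omega -> Y),
      iid_density mu P X g ->
      (arl_bound kappa_g A Imin <=
        \int[P]_w tau_G T b Theta theta0 eps A X w)%E.
  move=> [mg g0 _] [kappa [kappaE kg0 kg_inf]] d' Omega P X [mX lawX indepX].
  have kappa_ge theta : away Theta theta0 eps theta -> kappa_g <= kappa theta.
    move=> ath; apply: (le_trans kg_inf); apply: ge_inf; last by exists theta.
    (* The real [inf] is a lower bound only of a set bounded below; here 0 bounds it. *)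
    by exists 0 => _ [t /kappaE[/ltW t0 _] <-].
  pose p := expR (- (kappa_g * A)).
  have crossing theta k K : away Theta theta0 eps theta ->
      (P (alarm_from (crosses T b theta0 A X [set theta]) k K) <= p%:E)%E.
    move=> ath; have [k0 kE] := kappaE _ ath.
    have ml : measurable_fun setT (fun y => kappa theta * llr T b theta0 theta y).
      by apply: measurable_funM => //; exact: measurable_llr.
    apply: (@le_trans _ _ (expR (- (kappa theta * A)))%:E); last first.
      by rewrite lee_fin ler_expR lerN2 ler_wpM2r ?kappa_ge// ltW.
    (* Increments and level are both scaled by [kappa theta]; the moment condition bounds the mean
       of the exponential increments by 1. *)
    apply: (maximal_inequality mX indepX (k := k) (M := K) ml).
    - move=> i; rewrite -kE.
      rewrite (_ : (fun y => (lr T b theta0 theta y `^ kappa theta * g y)%:E) =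
        (fun y => (expR (kappa theta * llr T b theta0 theta y) * g y)%:E)).
        apply: (ge0_integral_law_le (mX i) mg g0 (lawX i)).
          exact: measurableT_comp.
        by move=> y; exact: expR_ge0.
      by apply/funext => y; rewrite /lr -expRM [llr _ _ _ _ _ * _]mulrC.
    - apply: bigcup_measurable => n _; apply: (sigma_block_measurable mX (m := k) (n := n)).
      exact: crosses_measurable.
    - move=> w [n /= kn [_ [-> At]]]; exists n; split => //.
      by rewrite -mulr_sumr ltr_pM2l.
  have I0 : I theta0 = 0%E by rewrite /I KL_expfam_refl.
  (* The divergence vanishes at [theta0] and increases strictly on both sides. *)
  have Imin0 : (0 < Imin)%E.
    rewrite lt_min -I0; apply/andP; split.
      by apply: incp => //; rewrite ltrDl.
    by apply: incm => //; rewrite ltrBlDr ltrDl.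
  (* [N] is the integer part of [A / Imin]; for infinite [Imin] the quotient is 0 and so is [N]. *)
  have [N [NA long]] : exists N : nat, (N%:R%:E <= A%:E / Imin)%E /\
      forall n, (N < n)%N -> (A%:E <= n%:R%:E * Imin)%E.
    case: Imin Imin0 => [r||//] r0.
      exists (Num.truncn (A / r)); rewrite inver gt_eqF// -EFinM !lee_fin.
      split; first by rewrite truncn_le ?divr_ge0 ?ltW.
      move=> n Nn; rewrite -EFinM lee_fin -ler_pdivrMr// ltW//.
      by rewrite (lt_le_trans (truncnS_gt _))// ler_nat.
    exists 0%N; rewrite invey mule0; split => // n n0.
    by rewrite gt0_muley ?leey// lte_fin ltr0n.
  have p0 : 0 < p by exact: expR_gt0.
  pose alpha := 2 * N.+1%:R * p.
  have alpha0 : 0 < alpha by rewrite !mulr_gt0.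
  pose cross := crosses T b theta0 A X (away Theta theta0 eps).
  have mcross m n k q : (m <= k)%N -> (q <= n)%N -> <<s block X m n >> (cross k q).
    exact: crosses_measurable.
  have alarm_le k M : (P (alarm_from cross k M) <= alpha%:E)%E.
    apply: (alarm_away_le mT h_ge0 f_density) => //; first exact: ltW.
    by move=> theta K; exact: crossing.
  have := le_integral_alarm_time mX indepX mcross alpha0 alarm_le.
  rewrite -tau_GE; apply: le_trans.
  (* The inverse of [alpha] is the claimed bound with [N] in place of [A / Imin], hence at least
     that bound. *)
  have -> : (alpha^-1)%:E = ((expR (kappa_g * A))%:E / (2%:E * (N%:R%:E + 1)))%E.
    rewrite -EFinD -EFinM inver gt_eqF ?mulr_gt0 ?ltr_wpDl// -EFinM.
    by rewrite /alpha /p expRN -[N.+1%:R]natr1 !invfM invrK mulrC.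
  rewrite /arl_bound lee_wpmul2l ?lee_fin ?expR_ge0// lee_pV2 ?inE.
  - by rewrite lee_wpmul2l ?lee_fin// leeD2r.
  - by rewrite mule_ge0// adde_ge0// (le_trans _ NA)// lee_fin.
  - by rewrite -EFinD -EFinM lee_fin mulr_ge0// addr_ge0.
split; first exact: part1.
(* The moment condition persists for any smaller positive constant, so part 1 applies with [ks]. *)
move=> G kappa ks Gd Gk ks0 ksk g Gg; apply: part1; first exact: Gd.
have [k [kE _ kinf]] := Gk _ Gg.
by exists k; split => //; exact: le_trans (ksk _ Gg) kinf.
Qed.
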